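(* Let $q=4$, let $e>2$ be an integer, and let $n=1+(q-1)\cdot q^{e-2}+1\cdot q^{e+1}$. Then $$g_{n,q}=S_e\,S_3^{q^{e-2}}+(S_2S_3)^{q^{e-2}}.$$ In particular, when $e=5$, $g_{n,q}$ is a permutation polynomial of $\mathbb{F}_{q^5}$.
   Context: For a prime power $q$ (a power of the prime $p$) and an integer $n\ge 0$, $g_{n,q}\in\mathbb{F}_p[X]$ denotes the unique polynomial satisfying $\sum_{a\in\mathbb{F}_q}(X+a)^n=g_{n,q}(X^q-X)$. For fixed $q$, $S_0=0$ and $S_k=X+X^q+X^{q^2}+\cdots+X^{q^{k-1}}$ for $k\ge1$. A polynomial over $\mathbb{F}_{Q}$ is a permutation polynomial of $\mathbb{F}_{Q}$ if the map it induces on $\mathbb{F}_{Q}$ is a bijection. *)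

(* Defs.v *)
From HB Require Import structures.
From mathcomp Require Import all_boot all_order all_algebra all_field.
From mathcomp Require Import zify.

Set Implicit Arguments.
Unset Strict Implicit.
Unset Printing Implicit Defensive.

Import GRing.Theory.
Local Open Scope ring_scope.

(* A ring morphism when R has prime characteristic p (Fp_inj_rmorph). *)
Definition Fp_inj (p : nat) (R : nzRingType) (x : 'F_p) : R := (x : nat)%:R.

Definition is_gpoly (p : nat) (F : finFieldType) (n : nat) (g : {poly 'F_p}) :=
  \sum_(a : F) ('X + a%:P) ^+ n == map_poly (@Fp_inj p F) g \Po ('X^#|F| - 'X).

Section FpInj.

Variables (p : nat) (F : fieldType).
Hypothesis pcharF : p \in [pchar F].

Let p_pr : prime p. Proof. exact: pcharf_prime pcharF. Qed.

Lemma Fp_inj_nat m : Fp_inj F (m%:R : 'F_p) = m%:R.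
Proof. by rewrite /Fp_inj val_Fp_nat // (GRing.natr_mod_pchar pcharF). Qed.

Lemma Fp_injD : {morph @Fp_inj p F : x y / x + y}.
Proof.
move=> x y; rewrite -[x in LHS]natr_Zp -[y in LHS]natr_Zp -natrD Fp_inj_nat.
by rewrite natrD.
Qed.

Lemma Fp_injM : {morph @Fp_inj p F : x y / x * y}.
Proof.
move=> x y; rewrite -[x in LHS]natr_Zp -[y in LHS]natr_Zp -natrM Fp_inj_nat.
by rewrite natrM.
Qed.

Lemma Fp_inj1 : Fp_inj F (1 : 'F_p) = 1.
Proof. exact: (Fp_inj_nat 1). Qed.

Lemma Fp_inj_rmorph : exists f : {rmorphism 'F_p -> F}, f =1 @Fp_inj p F.
Proof.
have fB : zmod_morphism (@Fp_inj p F).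
  move=> x y; apply/eqP; rewrite eq_sym subr_eq -Fp_injD subrK; exact: eqxx.
have fM : monoid_morphism (@Fp_inj p F) by split; [exact: Fp_inj1 | exact: Fp_injM].
pose aM := GRing.isZmodMorphism.Build 'F_p F (@Fp_inj p F) fB.
pose mM := GRing.isMonoidMorphism.Build 'F_p F (@Fp_inj p F) fM.
pose f : {rmorphism 'F_p -> F} := HB.pack (@Fp_inj p F) aM mM.
by exists f.
Qed.

Lemma Fp_inj_frob (x : F) : x ^+ p = x -> exists y : 'F_p, Fp_inj F y = x.
Proof.
have [f fE] := Fp_inj_rmorph; move=> xp.
have f_frob (y : 'F_p) : f y ^+ p = f y.
  rewrite -rmorphXn; congr (f _).
  by have := expf_card y; rewrite (card_Fp p_pr).
have [/mapP[y _ ->]|xNf] := boolP (x \in map f (enum 'F_p)).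
  by exists y; rewrite -fE.
have szP : size ('X^p - 'X : {poly F}) = p.+1.
  by rewrite size_polyDl ?size_polyXn // size_polyN size_polyX ltnS prime_gt1.
have P0 : 'X^p - 'X != 0 :> {poly F} by rewrite -size_poly_eq0 szP.
have rP (z : F) : z ^+ p = z -> root ('X^p - 'X) z.
  by move=> zp; rewrite rootE hornerD hornerN hornerXn hornerX zp subrr.
have /(_ (x :: map f (enum 'F_p))) := @max_poly_roots _ _ _ P0.
rewrite /= size_map -cardE card_Fp // szP ltnn xNf rP //=.
rewrite map_inj_uniq ?enum_uniq; last exact: fmorph_inj.
suff -> : all (root ('X^p - 'X)) (map f (enum 'F_p)) by move/(_ isT isT).
by apply/allP=> _ /mapP[y _ ->]; apply: rP.
Qed.

End FpInj.

Section Existence.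

Variables (p : nat) (F : finFieldType).
Hypothesis pcharF : p \in [pchar F].

Let q := #|F|.
Let T : {poly F} := 'X^q - 'X.
Let s n : {poly F} := \sum_(a : F) ('X + a%:P) ^+ n.

Let TDC a : ('X + a%:P) ^+ q = T + ('X + a%:P).
Proof.
apply/eqP; rewrite -subr_eq; apply/eqP.
have -> : ('X + a%:P) ^+ q - ('X + a%:P) = T \Po ('X + a%:P).
  by rewrite /T comp_polyB comp_Xn_poly comp_polyX.
rewrite /T finField_genPoly rmorph_prod /=.
rewrite (reindex_inj (addIr a)) /=; apply: eq_bigr => b _.
by rewrite comp_polyB comp_polyX comp_polyC polyCD opprD addrACA subrr addr0.
Qed.

Let s_rec n : s (n + q) = s n.+1 + T * s n.
Proof.
rewrite /s mulr_sumr -big_split /=; apply: eq_bigr => a _.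
by rewrite exprD TDC mulrDr addrC -exprSr [T * _]mulrC.
Qed.

Let s_small n : (n < q)%N -> s n = (\sum_(a : F) a ^+ n)%:P.
Proof.
move=> n_ltq; set c := (X in X%:P).
have s_val b : (s n).[b] = c.
  rewrite /s horner_sum /c [RHS](reindex_inj (addrI b)) /=.
  by apply: eq_bigr => a _; rewrite horner_exp !hornerE.
apply/eqP; rewrite -subr_eq0; apply/negPn/negP => P0.
have : (q < size (s n - c%:P)%R)%N.
  rewrite /q cardE; apply: max_poly_roots P0 _ (enum_uniq _).
  by apply/allP=> b _; rewrite rootE !hornerE s_val subrr.
apply/negP; rewrite -leqNgt.
apply: leq_trans n_ltq; apply: leq_trans (size_polyD _ _) _.
rewrite size_polyN geq_max (leq_trans (size_polyC_leq1 _)) // andbT.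
apply: leq_trans (size_sum _ _ _) _; apply/bigmax_leqP => a _.
apply: leq_trans (size_poly_exp_leq _ _) _.
by rewrite -[a]opprK polyCN size_XsubC mul1n.
Qed.

Lemma is_gpoly_exists n : exists g : {poly 'F_p}, is_gpoly F n g.
Proof.
have [f fE] := Fp_inj_rmorph pcharF.
have fpE : map_poly (@Fp_inj p F) =1 map_poly f.
  by move=> g; apply/eq_map_poly => x; rewrite fE.
have q_gt1 : (1 < q)%N := finNzRing_gt1 F.
elim/ltn_ind: n => n IHn; have [n_ltq|q_len] := ltnP n q.
  have [y yE] : exists y : 'F_p, Fp_inj F y = \sum_(a : F) a ^+ n.
    apply: (Fp_inj_frob pcharF).
    rewrite -(pFrobenius_autE pcharF) rmorph_sum /=.
    rewrite [RHS](reindex_inj (fmorph_inj (pFrobenius_aut pcharF))) /=.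
    by apply: eq_bigr => a _; rewrite rmorphXn.
  exists y%:P; rewrite /is_gpoly fpE map_polyC comp_polyC /= fE yE.
  exact/eqP/s_small.
have [g1 /eqP g1E] : exists g : {poly 'F_p}, is_gpoly F (n - q).+1 g.
  by apply: IHn; lia.
have [g0 /eqP g0E] : exists g : {poly 'F_p}, is_gpoly F (n - q) g.
  by apply: IHn; lia.
exists (g1 + 'X * g0); apply/eqP; rewrite -[n in LHS](subnK q_len) [LHS]s_rec.
rewrite [s _.+1]g1E [s (n - q)%N]g0E !fpE rmorphD rmorphM /= map_polyX.
by rewrite comp_polyD comp_polyM comp_polyX.
Qed.

Lemma is_gpoly_uniq n (g h : {poly 'F_p}) :
  is_gpoly F n g -> is_gpoly F n h -> g = h.
Proof.
have [f fE] := Fp_inj_rmorph pcharF.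
have fpE : map_poly (@Fp_inj p F) =1 map_poly f.
  by move=> k; apply/eq_map_poly => x; rewrite fE.
have q_gt1 : (1 < q)%N := finNzRing_gt1 F.
have T_gt1 : (1 < size T)%N.
  by rewrite /T size_polyDl size_polyXn ?size_polyN ?size_polyX // ltnW.
move=> /eqP gE /eqP; rewrite gE !fpE => /eqP.
rewrite -subr_eq0 -comp_polyB -rmorphB comp_poly_eq0 //.
by rewrite map_poly_eq0 subr_eq0 => /eqP.
Qed.

End Existence.

Lemma gpoly_subproof (p : nat) (F : finFieldType) (n : nat) :
  exists g : {poly 'F_p}, (p \in [pchar F]) ==> is_gpoly F n g.
Proof.
case: (boolP (p \in [pchar F])) => [pcharF|_]; last by exists 0.
by have [g gP] := is_gpoly_exists pcharF n; exists g.
Qed.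

(* g_{n,q} in F_p[X], where F is a field with q elements and characteristic p;
   it is the only polynomial satisfying is_gpoly, by is_gpoly_uniq, and a junk
   value when p is not the characteristic of F. *)
Definition gpoly (p : nat) (F : finFieldType) (n : nat) : {poly 'F_p} :=
  xchoose (gpoly_subproof p F n).

Lemma gpolyP (p : nat) (F : finFieldType) (n : nat) :
  p \in [pchar F] -> is_gpoly F n (gpoly p F n).
Proof. exact/implyP/(xchooseP (gpoly_subproof p F n)). Qed.

Definition Spoly (R : nzRingType) (q k : nat) : {poly R} :=
  \sum_(i < k) 'X^(q ^ i).

Definition perm_poly (K : finFieldType) (f : {poly K}) :=
  bijective (fun x : K => f.[x]).

(* Main.v *)
Require Import Defs.
From mathcomp Require Import all_boot all_order all_algebra all_field.
From mathcomp Require Import ring zify.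

(* With Q = q^(e-2) and q = 4, Frobenius turns the summand (X + a)^n into
   (X + a) (X^Q + a)^3 (X^(q^(e+1)) + a).  The power sums of F_4 of exponent 0,
   1, 2, 4 and 5 vanish and that of exponent 3 is 1, so the sum over a is
   (X + X^Q) (X^(q^(e+1)) + X^Q), which is S_(e-2) S_3^Q evaluated at X^q - X;
   finally S_e = S_(e-2) + S_2^Q.  For e = 5 the map is x |-> S_3(x)^65, where
   S_3 is an F_2-linear bijection of F_(4^5) and 65 is prime to 4^5 - 1. *)

Import GRing.Theory.
Local Open Scope ring_scope.

Lemma pcharf2_card_pow4 (K : finFieldType) m : #|K| = (4 ^ m)%N -> 2%N \in [pchar K].
Proof. by move=> cK; apply: (@card_finPcharP K 2 (2 * m)) => //; rewrite cK expnM. Qed.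

Lemma exprD_pow4 (R : comNzRingType) (k : nat) (x y : R) :
  2%N \in [pchar R] -> (x + y) ^+ (4 ^ k) = x ^+ (4 ^ k) + y ^+ (4 ^ k).
Proof.
move=> pR; apply: exprDn_pchar; apply: (sub_in_pnat (pi := 2%N)).
  by move=> ? _ /eqP ->.
by rewrite pnatX.
Qed.

Lemma map_Spoly (R S : nzRingType) (f : {rmorphism R -> S}) q k :
  map_poly f (Spoly R q k) = Spoly S q k.
Proof. by rewrite rmorph_sum; apply: eq_bigr => i _; rewrite /= map_polyXn. Qed.

(** In characteristic 2 the powers [(X^4 + X)^(4^i)] equal [X^(4^(i+1)) + X^(4^i)], so the sum
    telescopes. *)
Lemma Spoly_comp_genPoly (R : comNzRingType) k :
  2%N \in [pchar R] -> Spoly R 4 k \Po ('X^4 - 'X) = 'X^(4 ^ k) + 'X.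
Proof.
move=> pR; have pP : 2%N \in [pchar {poly R}] by rewrite pchar_poly.
rewrite (oppr_pchar2 pP); elim: k => [|k IHk].
  by rewrite /Spoly big_ord0 comp_poly0 expn0 expr1 (addrr_pchar2 pP).
rewrite /Spoly big_ord_recr /= comp_polyD IHk comp_Xn_poly.
rewrite exprD_pow4 // -exprM -expnS addrC -addrA.
by rewrite [X in _ + X]addrA (addrr_pchar2 pP) add0r.
Qed.

Lemma Spoly_shift (R : comNzRingType) k m : 2%N \in [pchar R] ->
  Spoly R 4 (k + m) = Spoly R 4 k + Spoly R 4 m ^+ (4 ^ k).
Proof.
move=> pR; have pP : 2%N \in [pchar {poly R}] by rewrite pchar_poly.
rewrite [LHS]big_split_ord /=; congr (_ + _).
elim: m => [|m IHm]; first by rewrite /Spoly !big_ord0 expr0n expn_eq0.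
by rewrite /Spoly !big_ord_recr /= IHm exprD_pow4 // -exprM expnD mulnC.
Qed.

Section PowerSums.

Variables (F : finFieldType).
Hypothesis cF : #|F| = 4%N.

(** Multiplication by some [u] outside [{0, 1}] permutes [F], so the sum is fixed by [u] and must
    vanish. *)
Lemma sum_F4 : \sum_(a : F) a = 0.
Proof.
have [u /andP[u0 u1]] : exists u : F, (u != 0) && (u != 1).
  have /card_gt0P[u] : (0 < #|~: [set (0%R : F); 1%R]|)%N.
    by have := cardsC [set (0 : F); 1%R]; rewrite cards2 cF; lia.
  by rewrite !inE negb_or; exists u.
have : \sum_(a : F) a = u * \sum_(a : F) a.
  by rewrite [LHS](reindex_inj (mulfI u0)) mulr_sumr.
move/eqP; rewrite -subr_eq0 -{1}[\sum_a a]mul1r -mulrBl mulf_eq0 subr_eq0.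
by rewrite eq_sym (negPf u1) => /eqP.
Qed.

Lemma sum_sqr_F4 : \sum_(a : F) a ^+ 2 = 0.
Proof.
have pF : 2%N \in [pchar F] by apply: (@pcharf2_card_pow4 F 1).
transitivity (pFrobenius_aut pF (\sum_(a : F) a)); last by rewrite sum_F4 rmorph0.
by rewrite rmorph_sum; apply: eq_bigr => a _; rewrite /= pFrobenius_autE.
Qed.

(** Each of the three nonzero elements has cube 1, and [3 = 1] in characteristic 2. *)
Lemma sum_cube_F4 : \sum_(a : F) a ^+ 3 = 1.
Proof.
have pF : 2%N \in [pchar F] by apply: (@pcharf2_card_pow4 F 1).
rewrite (bigD1 0) //= expr0n add0r (eq_bigr (fun=> 1)) => [|a a0].
  rewrite sumr_const (_ : #|_| = 3); last first.
    by have := cardC1 (0 : F); rewrite cF.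
  by rewrite mulrS mulr2n (addrr_pchar2 pF) addr0.
by apply: (mulfI a0); rewrite -exprS mulr1 -[in RHS](expf_card a) cF.
Qed.

(* Only the coefficient of [a ^+ 3], the second elementary symmetric function
   of [x, y, y, y, z], survives the summation. *)
Lemma sum_translates_F4 (x y z : {poly F}) :
  \sum_(a : F) (x + a%:P) * (y + a%:P) ^+ 3 * (z + a%:P) = (x + y) * (z + y).
Proof.
have pF : 2%N \in [pchar F] by apply: (@pcharf2_card_pow4 F 1).
have pP : 2%N \in [pchar {poly F}] by rewrite pchar_poly.
have sumX k : \sum_(a : F) a%:P ^+ k = (\sum_(a : F) a ^+ k)%:P.
  by rewrite rmorph_sum; apply: eq_bigr => a _; rewrite rmorphXn.
pose c0 := x * y ^+ 3 * z.
(* The product has degree 5 in [a]; since [a^4 = a], its coefficients at [a^4] and [a^5] are folded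
   into [c1] and [c2]. *)
pose c1 := y ^+ 3 * (x + z) + 3%:R * x * y ^+ 2 * z + (x + 3%:R * y + z).
pose c2 := 3%:R * x * y * z + 3%:R * y ^+ 2 * (x + z) + y ^+ 3 + 1.
pose c3 := x * z + 3%:R * y * (x + z) + 3%:R * y ^+ 2.
transitivity (\sum_(a : F) (c0 * a%:P ^+ 0 + c1 * a%:P ^+ 1
                            + c2 * a%:P ^+ 2 + c3 * a%:P ^+ 3)).
  apply: eq_bigr => a _.
  have a4 : a%:P ^+ 4 = a%:P :> {poly F} by rewrite -rmorphXn -cF /= expf_card.
  rewrite /c0 /c1 /c2 /c3; ring: a4.
rewrite !big_split /= -!mulr_sumr !sumX sum_sqr_F4 sum_cube_F4.
under eq_bigr do rewrite expr0.
rewrite sumr_const cF; under eq_bigr do rewrite expr1.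
rewrite sum_F4 (natrM F 2 2) (pcharf0 pF) mulr0 polyC0 !mulr0 !add0r mulr1.
transitivity ((x + y) * (z + y) + 2%:R * (y * (x + z) + y ^+ 2)).
  by rewrite /c3; ring.
by rewrite (pcharf0 pP) mul0r addr0.
Qed.

End PowerSums.

(** Bezout gives [u * m = v * (#|K| - 1) + 1], so raising to the power [u] undoes raising to the
    power [m], at 0 as well. *)
Lemma expf_inj_coprime (K : finFieldType) m :
  (0 < m)%N -> coprime m #|K|.-1 -> injective (fun x : K => x ^+ m).
Proof.
move=> m0 /eqP com x y /= exy.
have K0 : (0 < #|K|)%N by apply/card_gt0P; exists 0.
have expK j (z : K) : z ^+ (j * #|K|.-1 + 1) = z.
  elim: j => [|j IHj]; first by rewrite expr1.
  by rewrite mulSn -addnA exprD IHj -exprSr prednK // expf_card.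
case: (egcdnP #|K|.-1 m0) => u v; rewrite com => uv _.
by rewrite -[x](expK v) -[y](expK v) -uv mulnC !exprM exy.
Qed.

(* If [d] is in the kernel then [d ^+ 16 = d ^+ 4 + d], whence [d ^+ 64 = d];
   together with [d ^+ 4 ^ 5 = d] this gives [d ^+ 4 = d], so [d] is a root of
   [3 d = d]. *)
Lemma horner_Spoly3_inj (K : finFieldType) :
  #|K| = (4 ^ 5)%N -> injective (fun x => (Spoly K 4 3).[x]).
Proof.
move=> cK x y /=; have pK := pcharf2_card_pow4 _ _ cK.
have SE z : (Spoly K 4 3).[z] = z + z ^+ (4 ^ 1) + z ^+ (4 ^ 2).
  by rewrite /Spoly !big_ord_recr big_ord0 /= !hornerE.
have pow4D k (a b : K) := exprD_pow4 _ k a b pK.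
move/eqP; rewrite -subr_eq0 (oppr_pchar2 pK) !SE => /eqP Sxy.
apply/eqP; rewrite -subr_eq0 (oppr_pchar2 pK); move: Sxy.
rewrite addrACA (addrACA x) -!pow4D; move: (x + y) => d /eqP.
rewrite addrC addr_eq0 (oppr_pchar2 pK) => /eqP d2.
have d3 : d ^+ (4 ^ 3) = d.
  rewrite (expnD 4 2 1) exprM d2 pow4D -exprM -expnD d2.
  by rewrite addrCA (addrr_pchar2 pK) addr0.
have d2' : d ^+ (4 ^ 2) = d.
  by rewrite -[in LHS]d3 -exprM -expnD -cK expf_card.
have d1 : d ^+ (4 ^ 1) = d by rewrite -[in RHS]d3 (expnD 4 2 1) exprM d2'.
by move: d2; rewrite d2' d1 (addrr_pchar2 pK) => ->.
Qed.

Theorem proposition3p6 (q : nat) (hq : q = 4%N) (F : finFieldType)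
    (hF : #|F| = q) (e : nat) (he : (2 < e)%N) (n : nat)
    (hn : n = (1 + (q - 1) * q ^ (e - 2) + 1 * q ^ (e + 1))%N) :
  gpoly 2 F n =
    Spoly 'F_2 q e * Spoly 'F_2 q 3 ^+ (q ^ (e - 2))
    + (Spoly 'F_2 q 2 * Spoly 'F_2 q 3) ^+ (q ^ (e - 2))
  /\ (e = 5%N -> forall K : finFieldType, #|K| = (q ^ 5)%N ->
        perm_poly (map_poly (@Fp_inj 2 K) (gpoly 2 F n))).
Proof.
subst q.
have pF : 2%N \in [pchar F] by apply: (@pcharf2_card_pow4 F 1).
have gE : gpoly 2 F n = Spoly 'F_2 4 (e - 2) * Spoly 'F_2 4 3 ^+ (4 ^ (e - 2)).
  (* By uniqueness it is enough that the product satisfies the defining identity after substituting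
     [X^4 - X]. *)
  apply: (is_gpoly_uniq pF (gpolyP n pF)).
  have pP : 2%N \in [pchar {poly F}] by rewrite pchar_poly.
  have [f fE] := Fp_inj_rmorph pF.
  rewrite /is_gpoly -(eq_map_poly fE) rmorphM rmorphXn /= !map_Spoly.
  rewrite comp_polyM rmorphXn /= hF !Spoly_comp_genPoly // exprD_pow4 //.
  rewrite -exprM -expnD addnC (_ : e - 2 + 3 = e + 1)%N; last by lia.
  rewrite [_ + 'X]addrC -(sum_translates_F4 _ hF); apply/eqP/eq_bigr => a _.
  have aq k : a%:P ^+ (4 ^ k) = a%:P :> {poly F}.
    rewrite -rmorphXn /=; congr _%:P.
    by elim: k => [|k IHk]; rewrite ?expr1 // expnS exprM -[X in a ^+ X]hF
      expf_card.
  by rewrite hn mul1n mulnC exprD exprD expr1 exprM !exprD_pow4 // !aq.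
split=> [|e5 K cK].
  have pP : 2%N \in [pchar {poly 'F_2}] by rewrite pchar_poly pchar_Fp.
  rewrite gE exprMn -mulrDl.
  (* The cofactor of [S_3^Q] is [S_e + S_2^Q = S_(e-2) + S_2^Q + S_2^Q], where the last two terms
     cancel. *)
  rewrite -[X in Spoly _ _ X + _](subnK (ltnW he)) Spoly_shift ?pchar_Fp //.
  by rewrite -addrA (addrr_pchar2 pP) addr0.
have pK : 2%N \in [pchar K] by apply: (@pcharf2_card_pow4 K 5).
have [f fE] := Fp_inj_rmorph pK.
rewrite gE e5 -(eq_map_poly fE) rmorphM rmorphXn /= !map_Spoly.
apply: injF_bij => x y /=.
(* For [e = 5] both factors are powers of [S_3], as [e - 2 = 3]; they merge into exponent
   [4^3 + 1 = 5 * 13], coprime to [4^5 - 1 = 3 * 11 * 31]. *)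
rewrite (hornerM _ _ x) (hornerM _ _ y) !horner_exp -!exprS => exy.
apply: (horner_Spoly3_inj _ cK); apply: (@expf_inj_coprime K (4 ^ 3).+1) exy => //.
by rewrite cK.
Qed.
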